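(* Let $G\subset\mathbb{C}$ be a bounded simply connected domain, let $D$ be the open unit disk, and let $\varphi:G\to D$ be the Riemann map of $G$. Suppose $\varphi$ is continuous on $\overline{G}$ (i.e. $\varphi$ has a continuous extension to $\overline{G}$, again denoted $\varphi$). Then for each $z\in\overline{D}$ the set $\varphi^{-1}(z)=\{w\in\overline{G}:\varphi(w)=z\}$ is a connected closed subset of $\overline{G}$. Moreover, let $X=\{\varphi^{-1}(z): z\in\overline{D}\}$, equipped with the quotient topology from $\overline{G}$, and define $\hat\varphi:X\to\overline{D}$ by $\hat\varphi(\overline{x})=\varphi(x)$ for each $\overline{x}\in X$, where $x$ is any element of $\overline{x}$. Then $\hat\varphi$ is a homeomorphism from $X$ onto $\overline{D}$.
   Context: A simply connected domain is a connected open set $G\subset\mathbb{C}$ such that $(\mathbb{C}\cup\{\infty\})\setminus G$ is connected. The Riemann map of $G$ is an injective analytic function $\varphi$ from $G$ onto the open unit disk $D$. The quotient topology on $X$ is the one induced by the map $\overline{G}\to X$ sending $x$ to the fibre $\overline{x}=\varphi^{-1}(\varphi(x))$ containing it. *)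

(* Defs.v *)
From HB Require Import structures.
From mathcomp Require Import all_boot all_order all_algebra.
From mathcomp Require Import complex.
From mathcomp Require Import all_classical all_reals all_analysis.
Import numFieldNormedType.Exports.

Set Implicit Arguments.
Unset Strict Implicit.
Unset Printing Implicit Defensive.

Import Order.TTheory GRing.Theory Num.Theory.
Local Open Scope classical_set_scope.
Local Open Scope ring_scope.
Local Open Scope complex_scope.

(* The norm topology on the complex numbers [R[i]]. The norm [`|z|] takes its
   values in [R[i]]; [x < y] there entails that [y - x] is real. *)
HB.instance Definition _ (R : realType) := NormedModule.copy R[i] R[i]^o.

Section homeomorphism.
Context {X Y : topologicalType}.

Definition homeomorphism (h : X -> Y) : Prop :=
  continuous h /\
  exists g : Y -> X, [/\ cancel h g, cancel g h & continuous g].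

End homeomorphism.

(* The set of fibres [f @^-1` [set z]], [z : Y], as a type. *)
Definition fibre_space {T Y : Type} (f : T -> Y) : Type :=
  [set F : set T | exists z : Y, F = f @^-1` [set z]] : Type.

Section fibre_space.
Context {T : topologicalType} {Y : Type} (f : T -> Y).

HB.instance Definition _ := Choice.on (fibre_space f).

Definition fibre_set (F : fibre_space f) : set T := set_val F.

Definition fibre_of (x : T) : fibre_space f :=
  SigSub (mem_set (ex_intro _ (f x) erefl)).

(* [quotient_topology] is not applicable: a [quotType] needs a representative
   of every class, that is, the surjectivity of [f]. *)
Definition fibre_open (U : set (fibre_space f)) := open (fibre_of @^-1` U).

Let fibre_openT : fibre_open setT.
Proof. by rewrite /fibre_open preimage_setT; exact: openT. Qed.

Let fibre_openI : setI_closed fibre_open.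
Proof. by move=> U V oU oV; exact: openI. Qed.

Let fibre_open_bigU (I : Type) (U : I -> set (fibre_space f)) :
  (forall i, fibre_open (U i)) -> fibre_open (\bigcup_i U i).
Proof.
by move=> oU; rewrite /fibre_open preimage_bigcup; apply: bigcup_open => i _;
  exact: oU.
Qed.

HB.instance Definition _ := isOpenTopological.Build (fibre_space f)
  fibre_openT fibre_openI fibre_open_bigU.

End fibre_space.

Section complex_plane.
Context {R : realType}.
Implicit Types (G : set R[i]) (f phi : R[i] -> R[i]).

Definition unit_disk : set R[i] := [set z | `|z| < 1].

(* [one_point_compactification R[i]] is the Riemann sphere. *)
Definition simply_connected_domain G : Prop :=
  [/\ open G, connected G &
      connected (~` (Some @` G) : set (one_point_compactification R[i]))].

(* Local representability by convergent power series. For open [G] the radius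
   can be taken so small that the disk lies in [G], so the values of [f]
   outside [G] are irrelevant. *)
Definition analytic_on G f : Prop :=
  forall z, G z -> exists (a : nat -> R[i]) (r : R[i]), 0 < r /\
    forall w, `|w - z| < r -> [series a n * (w - z) ^+ n]_n @ \oo --> f w.

Definition riemann_map G phi : Prop :=
  [/\ analytic_on G phi, {in G &, injective phi} & phi @` G = unit_disk].

Lemma riemann_map_closure G phi :
  riemann_map G phi -> {within closure G, continuous phi} ->
  {homo phi : w / closure G w >-> closure unit_disk w}.
Proof.
move=> [_ _ phiG] cphi x Gx B nB.
have /cphi : nbhs (phi (x : subspace (closure G))) B by [].
rewrite /nbhs /= -nbhs_subspace_in // => nx.
have [y [Gy yB]] := Gx _ nx.
exists (phi y); split; first by rewrite -phiG; exists y.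
by apply: yB; exact: subset_closure.
Qed.

(* The extended map, from the subtype [closure G] to the subtype
   [closure unit_disk], both with the induced topology. *)
Definition closure_map G phi (rphi : riemann_map G phi)
    (cphi : {within closure G, continuous phi}) :
    closure G -> closure unit_disk :=
  sigLR (mkfun_fun (riemann_map_closure rphi cphi)).

Lemma closure_mapE G phi (rphi : riemann_map G phi)
    (cphi : {within closure G, continuous phi}) (w : closure G) :
  set_val (closure_map rphi cphi w) = phi (set_val w).
Proof. by []. Qed.

End complex_plane.

Arguments unit_disk : clear implicits.

(* Main.v *)
Require Import Defs.
From HB Require Import structures.
From mathcomp Require Import all_boot all_order all_algebra.
From mathcomp Require Import complex ring.
From mathcomp Require Import all_classical all_reals all_analysis.
Import numFieldNormedType.Exports.
Import Order.TTheory GRing.Theory Num.Theory.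
Local Open Scope classical_set_scope.
Local Open Scope ring_scope.
Local Open Scope complex_scope.

(* Every continuous map from a compact space onto a Hausdorff space is closed,
   hence a quotient map; this gives the homeomorphism. A fibre over [z] is the
   intersection of the closures of the sets [phi^-1 (D `&` ball z e)], [e > 0],
   and each of these is connected, being the image of a convex set under the
   inverse of the Riemann map. Continuity of this inverse is the open mapping
   theorem for [phi], obtained by minimising [`|phi - w|] on a closed disk: if
   the minimum were attained at an interior point with a nonzero value, the
   first nonconstant term of the power series there would allow one to decrease
   it further. *)

(** * Power series: tail estimates and local decrease of [|f - w|] *)

Section power_series.
Context {K : numFieldType}.
Implicit Types (a : nat -> K) (f : K -> K) (z u : K).

(** The termwise hypothesis covers two cases at once: [u = z], and the vanishing of every
    coefficient after [a 0]. *)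
Lemma power_series_eq0 a z f u :
  (forall n, a n.+1 * (u - z) ^+ n.+1 = 0) ->
  [series a n * (u - z) ^+ n]_n @ \oo --> f u -> f u = a 0%N.
Proof.
move=> a0 fu; apply: (cvg_unique _ fu); first exact: norm_hausdorff.
apply: cvg_near_cst; exists 1%N => // -[//|n] _ /=.
by rewrite /series /= big_nat_recl //= expr0 mulr1 big1 ?addr0.
Qed.

(** Bounded partial sums at [rho] bound the terms there, so at [h] the series is dominated by a
    geometric one of ratio at most 1/2. The bound is uniform in [N], so only finite sums need
    comparing. *)
Lemma power_series_tail a (rho : K) : 0 < rho ->
  cvgn [series a n * rho ^+ n]_n ->
  exists2 M : K, 0 <= M & forall (h : K) m N, (m <= N)%N -> 2 * `|h| <= rho ->
    `|[series a n * h ^+ n]_n N - [series a n * h ^+ n]_n m|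
      <= M * (`|h| / rho) ^+ m.
Proof.
move=> rho0 /cvg_seq_bounded[M0 [M0r /(_ (`|M0| + 1))]].
have M0M : M0 < `|M0| + 1.
  by rewrite (le_lt_trans (real_ler_norm M0r)) // ltrDl.
move=> /(_ M0M) /=; set M := `|M0| + 1 => Mb.
have M_ge0 : 0 <= M by rewrite addr_ge0.
(* A term is the difference of two consecutive partial sums, each bounded by [M]. *)
have am n : `|a n| * rho ^+ n <= M + M.
  have -> : `|a n| * rho ^+ n =
      `|[series a n * rho ^+ n]_n n.+1 - [series a n * rho ^+ n]_n n|.
    by rewrite /series /= big_nat_recr //= addrAC subrr add0r normrM normrX
      (gtr0_norm rho0).
  by rewrite (le_trans (ler_normB _ _))// lerD//; apply: Mb.
exists ((M + M) * 2) => [|h m N mN h2]; first by rewrite mulr_ge0// addr_ge0.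
set t := `|h| / rho.
have t0 : 0 <= t by rewrite divr_ge0// ltW.
have t1 : 2 * t <= 1 by rewrite mulrA ler_pdivrMr// mul1r.
have step n : `|a n * h ^+ n| <= (M + M) * t ^+ n.
  have -> : `|a n * h ^+ n| = `|a n| * rho ^+ n * t ^+ n.
    by rewrite normrM normrX -mulrA -exprMn mulrCA divff ?mulr1// gt_eqF.
  by rewrite ler_wpM2r// exprn_ge0.
(* Subtracting [t ^+ N] strengthens the bound enough for induction on [N]: the step reduces to
   [t ^+ N * (1 - 2 * t) >= 0]. *)
suff : `|[series a n * h ^+ n]_n N - [series a n * h ^+ n]_n m|
      <= (M + M) * 2 * (t ^+ m - t ^+ N).
  move=> /le_trans; apply; apply: ler_wpM2l; first by rewrite mulr_ge0//
    addr_ge0.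
  by rewrite gerBl exprn_ge0.
elim: N mN => [|N IH]; first by rewrite leqn0 => /eqP ->;
  rewrite !subrr normr0 mulr0.
rewrite leq_eqVlt => /predU1P[->|]; first by rewrite !subrr normr0 mulr0.
rewrite ltnS => /IH {}IH.
rewrite /series /= big_nat_recr//= addrAC (le_trans (ler_normD _ _))//.
apply: (le_trans (lerD IH (step N))).
rewrite -subr_ge0 exprS.
have -> : (M + M) * 2 * (t ^+ m - t * t ^+ N)
    - ((M + M) * 2 * (t ^+ m - t ^+ N) + (M + M) * t ^+ N)
  = (M + M) * (t ^+ N * (1 - 2 * t)) by ring.
by rewrite mulr_ge0 ?addr_ge0// mulr_ge0 ?exprn_ge0// subr_ge0.
Qed.

End power_series.

(** Local minimum modulus principle. Algebraic closedness provides the root that turns the first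
    nonconstant term against [f z - w]. *)
Lemma power_series_decrease (K : numClosedFieldType) (a : nat -> K)
    (f : K -> K) (z w r e : K) : 0 < r ->
  (forall u, `|u - z| < r -> [series a n * (u - z) ^+ n]_n @ \oo --> f u) ->
  (exists2 u, `|u - z| < r & f u <> f z) -> f z != w -> 0 < e ->
  exists2 u, `|u - z| < e & `|f u - w| < `|f z - w|.
Proof.
move=> r0 fs [u ur fuz] fzw e0.
have fz : f z = a 0%N.
  apply: (@power_series_eq0 _ a z f z); last by apply: fs; rewrite subrr normr0.
  by move=> n; rewrite subrr exprS mul0r mulr0.
have ak : exists k, a k.+1 != 0.
  apply: contrapT => /forallNP a0; apply: fuz; rewrite fz.
  apply: power_series_eq0 (fs _ ur) => n.
  by move: (a0 n) => /negP; rewrite negbK => /eqP ->; rewrite mul0r.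
have [k {}ak kmin] : exists2 k, a k.+1 != 0 & forall j, (j < k)%N -> a j.+1 = 0.
  case: (ex_minnP ak) => k ? kmin; exists k => // j; rewrite ltnNge.
  by apply: contraNeq; exact: kmin.
(* A radius strictly inside the disk, so that the series converges at [z + rho]. *)
pose rho := r / 2.
have rho0 : 0 < rho by rewrite divr_gt0.
have rhor : rho < r by rewrite ltr_pdivrMr// ltr_pMr// ltr1n.
have [|M M0 tail] := power_series_tail a rho rho0.
  have := fs (z + rho); rewrite addrAC subrr add0r (gtr0_norm rho0).
  by move=> /(_ rhor) /cvgP.
pose c := f z - w; have c0 : c != 0 by rewrite subr_eq0.
have nc0 : 0 < `|c| by rewrite normr_gt0.
(* With [u = z + s * zeta] the leading terms of [f u - w] add up to
   [c * (1 - s ^+ k.+1)], while the tail is [O(s ^+ k.+2)]. *)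
pose zeta := k.+1.-root (- c / a k.+1).
pose tau := `|zeta| / rho; pose C := M * tau ^+ k.+2.
have tau0 : 0 <= tau by rewrite divr_ge0// ltW.
have C0 : 0 <= C by rewrite mulr_ge0// exprn_ge0.
(* With [s] the inverse of [D], the summands of [D] secure in turn [s <= 1],
   [2 * |s * zeta| <= rho], [s * C <= |c| / 2] and [|s * zeta| < e]. *)
pose D := 1 + 2 * tau + 2 * C / `|c| + `|zeta| / e.
have t1 : 0 <= 2 * tau by rewrite mulr_ge0.
have t2 : 0 <= 2 * C / `|c| by rewrite divr_ge0// mulr_ge0.
have t3 : 0 <= `|zeta| / e by rewrite divr_ge0// ltW.
have D1 : 1 <= D by rewrite /D -!addrA lerDl !addr_ge0.
have D0 : 0 < D by rewrite (lt_le_trans ltr01).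
pose s := D^-1.
have s0 : 0 < s by rewrite invr_gt0.
have s1 : s <= 1 by rewrite invf_le1.
have sh : 2 * `|s * zeta| <= rho.
  rewrite normrM (gtr0_norm s0) mulrCA ler_pdivrMl// -ler_pdivrMr// -mulrA.
  by rewrite /D addrAC -addrA -addrA addrCA lerDl !addr_ge0.
have se : `|s * zeta| < e.
  rewrite normrM (gtr0_norm s0) ltr_pdivrMl// -ltr_pdivrMr//.
  by rewrite ltrDr !ltr_pwDl.
have sC : s * C <= `|c| / 2.
  rewrite ler_pdivlMr// -mulrA ler_pdivrMl// -ler_pdivrMr// [C * 2]mulrC.
  by rewrite /D addrAC lerDr !addr_ge0.
have hr : `|s * zeta| < r.
  rewrite (le_lt_trans _ rhor)// (le_trans _ sh)//.
  by rewrite ler_peMl// ler1n.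
exists (z + s * zeta); first by rewrite addrAC subrr add0r.
have := fs (z + s * zeta); rewrite addrAC subrr add0r => /(_ hr).
(* The leading terms gain [|c| * s ^+ k.+1]. Half of this pays for the distance from the partial sum
   to the limit, strictly, and half for the tail from [k.+2] on. *)
move=> /cvgrPdist_lt /(_ (`|c| / 2 * s ^+ k.+1)) [];
  first by rewrite mulr_gt0 ?divr_gt0 ?exprn_gt0.
move=> N0 _ /(_ (maxn N0 k.+2)); rewrite /= leq_maxl => /(_ isT).
set N := maxn N0 k.+2; set SN := series _ N => fN.
have := tail (s * zeta) k.+2 N (leq_maxr _ _) sh; rewrite -/SN.
set Sk := series _ k.+2 => Nk.
(* Below order [k.+2] only the terms of order 0 and [k.+1] survive, and
   [zeta ^+ k.+1 = - c / a k.+1]. *)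
have Skw : Sk - w = c * (1 - s ^+ k.+1).
  rewrite /Sk /series /= big_nat_recr//= big_nat_recl//= big_nat big1 =>
    [|j /= jk].
    rewrite addr0 expr0 mulr1 -fz exprMn rootCK// mulrCA [_ * (- c / _)]mulrC.
    by rewrite divfK// /c; ring.
  by rewrite kmin// mul0r.
have -> : f (z + s * zeta) - w = (f (z + s * zeta) - SN) + (SN - Sk) + (Sk - w)
  by ring.
rewrite (le_lt_trans (ler_normD _ _))//
  (le_lt_trans (lerD (ler_normD _ _) (lexx _)))//.
have sk1 : s ^+ k.+1 <= 1 by rewrite exprn_ile1// ltW.
rewrite Skw normrM -/c (ger0_norm (_ : 0 <= 1 - s ^+ k.+1)) ?subr_ge0//.
have Nk' : `|SN - Sk| <= `|c| / 2 * s ^+ k.+1.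
  apply: (le_trans Nk).
  have -> : M * (`|s * zeta| / rho) ^+ k.+2 = s * C * s ^+ k.+1.
    by rewrite normrM (gtr0_norm s0) -[s * _ / _]mulrA -/tau exprMn mulrCA [s
      ^+ k.+2]exprS mulrAC.
  by rewrite ler_wpM2r// exprn_ge0// ltW.
rewrite [ltRHS](_ : _ = `|c| / 2 * s ^+ k.+1 + `|c| / 2 * s ^+ k.+1 + `|c| * (1
  - s ^+ k.+1)); last by field.
by rewrite ltrD2r ltr_leD.
Qed.

(** * Norm minima and compactness in the complex plane *)

Section complex_topology.
Context {R : realType}.

Lemma normc_Re (z : R[i]) : `|z| = (complex.Re `|z|)%:C.
Proof. by rewrite normc_def. Qed.

Lemma continuous_real_complex : continuous (real_complex R : R -> R[i]).
Proof.
move=> x; apply/cvgrPdist_lt => -[e e']; rewrite ltcE /= => /andP[/eqP -> e0].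
apply/nbhs_ballP; exists e => //= y; rewrite /ball /= => xy.
by rewrite -rmorphB normc_def /= expr0n addr0 sqrtr_sqr ltcR.
Qed.

Lemma continuous_Re : continuous (@complex.Re R : R[i] -> R).
Proof.
move=> z; apply: (iffRL (cvgrPdist_lt (FF := nbhs_filter (z : R[i])) _ _)) =>
  e e0.
apply/nbhs_ballP; exists e%:C => /=; first by rewrite ltcR.
move=> y; rewrite -ball_normE /= => zy.
by rewrite -raddfB -ltcR; apply: le_lt_trans zy; exact: normc_ge_Re.
Qed.

(** Norms lie in [R[i]], which is only partially ordered; the extreme value theorem is applied to
    their real parts. *)
Lemma compact_norm_min (T : topologicalType) (A : set T) (f : T -> R[i]) :
  A !=set0 -> compact A -> {within A, continuous f} ->
  exists2 c, A c & forall t, A t -> `|f c| <= `|f t|.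
Proof.
move=> A0 cA cf.
have [|c /set_mem Ac cmin] := @compact_EVT_min _ _ (fun t =>
  complex.Re `|f t|) A A0 cA.
  move=> t; apply: (@continuous_comp (subspace A) R[i] R f (fun z =>
    complex.Re `|z|)); first exact: cf.
  apply: (@continuous_comp R[i] R[i] R (fun z : R[i] => `|z|)); first exact:
    norm_continuous.
  exact: continuous_Re.
exists c => // t At; rewrite normc_Re [leRHS]normc_Re lecR.
by apply: cmin; exact: mem_set.
Qed.

(** Heine-Borel: [A] is a closed subset of the continuous image of a compact square. *)
Lemma complex_bounded_closed_compact (A : set R[i]) :
  bounded_set A -> closed A -> compact A.
Proof.
move=> [M [Mr MA]] cA.
pose m := complex.Re `|M| + 1.
pose f (p : R * R) : R[i] := p.1%:C + 'i * p.2%:C.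
have cf : continuous f.
  move=> p; apply: cvgD; first by apply: continuous_comp; [exact:
    cvg_fst|exact: continuous_real_complex].
  apply: cvgM; first exact: cvg_cst.
  by apply: continuous_comp; [exact: cvg_snd|exact: continuous_real_complex].
have Km := compact_setX (@segment_compact R (- m) m) (@segment_compact R (- m)
  m).
apply: (subclosed_compact cA (continuous_compact (continuous_subspaceT cf) Km)).
move=> z Az.
have zm : `|z| <= m%:C.
  apply: MA => //. rewrite /m rmorphD/= -normc_Re.
  by rewrite (le_lt_trans (real_ler_norm Mr)) // ltrDl.
exists (complex.Re z, complex.Im z) => /=; last first.
  by case: z {Az zm} => x y; rewrite /f /=; simpc.
split; rewrite /= in_itv /= -ler_norml -lecR; apply: le_trans zm.
  exact: normc_ge_Re.
rewrite normc_def lecR -sqrtr_sqr ler_sqrt ?addr_ge0 ?sqr_ge0//.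
by rewrite lerDr sqr_ge0.
Qed.

End complex_topology.

(** * The open mapping theorem for injective analytic maps *)

Lemma closed_norm_le (K : numFieldType) (V : normedModType K) (x : V) (d : K) :
  closed [set y | `|x - y| <= d].
Proof.
move=> y cy; apply/ler_addgt0Pr => e e0.
have [z [/= xz]] := cy _ (nbhsx_ballx y e e0).
rewrite -ball_normE /= => yz.
by rewrite -(subrKA z) (le_trans (ler_normD _ _))// lerD// distrC ltW.
Qed.

Lemma injective_analytic_nbhs (R : realType) (G : set R[i])
    (phi : R[i] -> R[i]) (z0 : R[i]) (V : set R[i]) :
  open G -> analytic_on G phi -> {in G &, injective phi} ->
  {within G, continuous phi} -> G z0 -> nbhs z0 V ->
  nbhs (phi z0) (phi @` (V `&` G)).
Proof.
move=> oG anphi injphi cphi Gz0 z0V.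
have /nbhs_ballP[e /= e0 eVG] : nbhs z0 (V `&` G).
  by apply: filterI => //; exact: open_nbhs_nbhs.
pose d := e / 2; pose K := closed_ball_ Num.norm z0 d.
have d0 : 0 < d by rewrite divr_gt0.
have de : d < e by rewrite ltr_pdivrMr// ltr_pMr// ltr1n.
have KVG : K `<=` V `&` G.
  by move=> z /= zd; apply: eVG; rewrite -ball_normE /= (le_lt_trans zd).
have KG : K `<=` G by move=> z /KVG[].
have cK : compact K.
  apply: complex_bounded_closed_compact; last exact: closed_norm_le.
  exists (`|z0| + d); split; first by rewrite ger0_real// addr_ge0// ltW.
  move=> M /ltW lM z /= zd; apply: le_trans lM.
  by rewrite -lerBlDl (le_trans (lerB_dist _ _))// distrC.
have cdist w (A : set R[i]) : A `<=` G -> {within A, continuous (fun z =>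
  phi z - w)}.
  move=> AG z; apply: (@cvgB R[i] R[i]); last exact: cvg_cst.
  by apply: (continuous_subspaceW AG).
(* The bounding circle. By injectivity [phi - phi z0] has no zero on it, so its minimal modulus [m]
   there is positive. *)
pose S := K `&` ~` ball z0 d.
have cS : compact S.
  apply: subclosed_compact cK _; last by move=> z [].
  by apply: closedI; [exact: closed_norm_le|exact/open_closedC/ball_open].
have Sd z : S z -> `|z0 - z| = d.
  move=> [zd]; rewrite -ball_normE /= => /negP; rewrite lt_neqAle.
  by rewrite [_ <= d]zd andbT negbK => /eqP.
have [|c Sc cmin] :=
  compact_norm_min _ _ _ _ cS (cdist (phi z0) S (subset_trans (@subIsetl _ _ _)
    KG)).
  exists (z0 + d); split;
    rewrite /K -?ball_normE /closed_ball_/= opprD addrA subrr add0r normrN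
      gtr0_norm//.
  by rewrite ltxx.
set m := `|phi c - phi z0| in cmin.
have m0 : 0 < m.
  rewrite normr_gt0 subr_eq0; apply/eqP => /injphi cz.
  have := Sd _ Sc; rewrite cz ?inE// ?subrr ?normr0; first by move/eqP;
    rewrite lt_eqF.
  exact: KG Sc.1.
apply/nbhs_ballP; exists (m / 2) => /=; first by rewrite divr_gt0.
move=> w; rewrite -ball_normE /= => wm.
have Kz0 : K z0 by rewrite /K /closed_ball_ /= subrr normr0 ltW.
have [|z1 Kz1 z1min] := compact_norm_min _ _ _ _ cK (cdist w K KG).
  by exists z0.
have [<-|/eqP z1w] := pselect (phi z1 = w); first by exists z1 => //; exact:
  KVG.
have z1d : `|z0 - z1| < d.
  (* On the circle [|phi z1 - w|] is at least [m / 2], whereas the centre already gives a value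
     below [m / 2]. *)
  rewrite lt_neqAle [_ <= d]Kz1 andbT; apply/eqP => z1d.
  have /cmin mz1 : S z1 by split=> //; rewrite -ball_normE /= z1d ltxx.
  have := z1min _ Kz0; apply/negP; rewrite -real_ltNge//.
  rewrite (lt_le_trans wm)// -(lerD2r (m / 2)) -splitr (le_trans mz1)//.
  rewrite -(subrKA w) (le_trans (ler_normD _ _))// lerD2l.
  by rewrite distrC ltW.
have [a [r [r0 ra]]] := anphi _ (KG _ Kz1).
(* The radius [d - |z0 - z1|] keeps the better point [u] inside [K], against the minimality of
   [z1]. *)
have [| |u] := power_series_decrease _ a phi z1 w r (d - `|z0 - z1|) r0 ra _
  z1w.
(* Nonconstancy near [z1]: injectivity separates the values at [z1] and at a nearby point of [G]. *)
- have /nbhs_ballP[t /= t0 tG] : nbhs z1 (G `&` ball z1 r).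
    apply: filterI; last exact: nbhsx_ballx.
    by apply: open_nbhs_nbhs; split => //; exact: KG.
  have [|Gu ru] := tG (z1 + t / 2).
    rewrite -ball_normE /= opprD addrA subrr add0r normrN gtr0_norm ?divr_gt0//.
    by rewrite ltr_pdivrMr// ltr_pMr// ltr1n.
  exists (z1 + t / 2); first by rewrite distrC; move: ru; rewrite -ball_normE.
  move=> /injphi; rewrite !inE => /(_ Gu (KG _ Kz1)) /eqP.
  by rewrite -subr_eq0 addrAC subrr add0r gt_eqF// divr_gt0.
- by rewrite subr_gt0.
rewrite ltrBrDl => ud uw.
have /z1min : K u.
  apply: ltW; apply: le_lt_trans ud.
  by rewrite -(subrKA z1) (le_trans (ler_normD _ _))// lerD2l distrC.
by move=> /(lt_le_trans uw); rewrite ltxx.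
Qed.

(** * The space of fibres and the connectedness of a fibre *)

Lemma fibre_setP (T : topologicalType) (Y : Type) (f : T -> Y)
    (F : fibre_space f) :
  exists y, fibre_set F = f @^-1` [set y].
Proof. by case: F => F /= FP; exact: set_mem FP. Qed.

Lemma fibre_space_homeomorphism (T Y : topologicalType) (f : T -> Y) :
  compact [set: T] -> hausdorff_space Y -> continuous f ->
  (forall y, exists x, f x = y) ->
  exists h : fibre_space f -> Y,
    (forall (F : fibre_space f) x, fibre_set F x -> h F = f x) /\
    homeomorphism h.
Proof.
move=> cT hY cf surjf.
have /choice[h hE] := fibre_setP _ _ f.
have hP (F : fibre_space f) x : fibre_set F x -> h F = f x by rewrite hE.
pose g y : fibre_space f := SigSub (mem_set (ex_intro _ y erefl)).
have fibre_ofE x : fibre_of f x = g (f x) by exact: val_inj.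
exists h; split => //; split.
  apply/continuousP => A oA.
  have -> : open (h @^-1` A) = open (f @^-1` A); last by move/continuousP: cf;
    exact.
  rewrite [LHS](_ : _ = open (fibre_of f @^-1` (h @^-1` A)))//; congr open.
  by apply/seteqP; split=> x /=; rewrite (hP (fibre_of f x) x).
exists g; split.
- by move=> F; apply: val_inj => /=; rewrite -hE.
- by move=> y; have [x fx] := surjf y; rewrite (hP (g y) x).
apply/continuousP => U oU.
(* By surjectivity [g] pulls [U] back to the complement of the image of a closed, hence compact,
   set; that image is closed. *)
have -> : g @^-1` U = ~` (f @` (~` (fibre_of f @^-1` U))).
  apply/seteqP; split=> y /= Uy.
    by move=> [x /= + xy]; rewrite fibre_ofE xy.
  apply: contrapT => nUy; apply: Uy; have [x fx] := surjf y.
  by exists x => //=; rewrite fibre_ofE fx.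
apply: closed_openC; apply: (compact_closed hY).
apply: continuous_compact; first exact: continuous_subspaceT.
by apply: (subclosed_compact _ cT) => //; exact: open_closedC.
Qed.

Lemma connected_fibre (T Y : topologicalType) (f : T -> Y) (y : Y) :
  compact [set: T] -> hausdorff_space T -> hausdorff_space Y -> continuous f ->
  (forall N, nbhs y N -> exists C, [/\ connected C, C `<=` f @^-1` N &
     f @^-1` [set y] `<=` closure C]) ->
  connected (f @^-1` [set y]).
Proof.
move=> cT hT hY cf fC; apply/connectedP => E [E0 KE [Eft Etf]].
have cK : closed (f @^-1` [set y]).
  apply: closed_comp => // ; apply: compact_closed => //; exact: compact_set1.
have Kcl b : closure (E b) `<=` f @^-1` [set y].
  rewrite [X in _ `<=` X](iffLR (closure_id _) cK); apply: closure_subset.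
  by rewrite KE; case: b; [exact: subsetUr|exact: subsetUl].
have cEf : closed (E false).
  move=> x Ex; have := Kcl false x Ex; rewrite KE => -[//|Etx].
  by have : set0 x by rewrite -Eft.
have cEt : closed (E true).
  move=> x Ex; have := Kcl true x Ex; rewrite KE => -[Etx|//].
  by have : set0 x by rewrite -Etf.
(* Normality gives a neighbourhood [U] of [E false] whose closure misses [E true]; the separating
   open sets are the interior of [U] and the complement of its closure. *)
have [|U EU UE] := @compact_normal _ hT cT _ cEf (~` E true).
  apply/set_nbhsP; exists (~` E true); split=> //; first exact: closed_openC.
  move=> x Efx Etx; have : set0 x by rewrite -Eft; split => //; exact:
    subset_closure.
  by [].
have EUo : E false `<=` U^°.
  by have /set_nbhsP[B [oB EB BU]] := EU; apply: (subset_trans EB);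
    rewrite -open_subsetE.
pose W := ~` closure U.
have oW : open W by exact/closed_openC/closed_closure.
have WU : closure W `<=` ~` U^°.
  rewrite [X in _ `<=` X](iffLR (closure_id _) (open_closedC (@open_interior _
    U))).
  apply: closure_subset => x Wx Ux; apply: Wx.
  apply: subset_closure; exact: interior_subset.
(* The tube argument: [f] is a closed map, so [N] is open, and everything over [N] lies in the two
   open sets. *)
pose N := ~` (f @` (~` (U^° `|` W))).
have yN : nbhs y N.
  apply: open_nbhs_nbhs; split.
    apply: closed_openC; apply: (compact_closed hY).
    apply: continuous_compact; first exact: continuous_subspaceT.
    apply: (subclosed_compact _ cT) => //; apply: open_closedC.
    by apply: openU => //; exact: open_interior.
  move=> [x /= nx fx]; apply: nx.
  have : (f @^-1` [set y]) x by [].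
  by rewrite KE => -[/EUo|Etx]; [left|right => /UE].
have [C [connC CN KC]] := fC _ yN.
have CUW : C `<=` U^° `|` W.
  by move=> x /CN nx; apply: contrapT => nUW; apply: nx; exists x.
have sepUW : separated U^° W.
  split; apply/seteqP; split=> // x [].
    by move=> /(closure_subset (@interior_subset _ U)) + Wx.
  by move=> Ux /WU.
have [CU|CW] := connected_subset sepUW CUW connC.
  have [x Ex] := E0 true; apply: (UE x) => //.
  apply: (closure_subset (@interior_subset _ U)); apply: (closure_subset CU).
  by apply: KC; rewrite KE; right.
have [x Ex] := E0 false; apply: (WU x); last exact: EUo.
by apply: (closure_subset CW); apply: KC; rewrite KE; left.
Qed.

(** * Subsets as spaces with the induced topology, and density *)

Lemma compact_set_type (T : topologicalType) (A : set T) :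
  compact A -> compact [set: A].
Proof.
move=> cA F FF _.
have [|p [Ap clp]] := cA (set_val @ F) _.
  by apply: (@filterS _ F _ setT) => [x _|]; [exact: set_valP|exact: filterT].
exists (SigSub (mem_set Ap)); split => // B C FB [_ [] [U oU <-] Up UC].
have [_ [[x Bx <-] Ux]] : (set_val @` B) `&` U !=set0.
  apply: clp; first by apply: (@filterS _ F _ B) => // x Bx; exists x.
  exact: open_nbhs_nbhs.
by exists x; split => //; exact: UC.
Qed.

Lemma nbhs_set_val (T : topologicalType) (A : set T) (x : A) (U : set T) :
  nbhs (set_val x) U -> nbhs x (set_val @^-1` U).
Proof. exact: (@initial_continuous _ _ set_val). Qed.

Lemma hausdorff_set_type (T : topologicalType) (A : set T) :
  hausdorff_space T -> hausdorff_space A.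
Proof.
move=> hT p q pq; apply: val_inj; apply: hT => B C pB qC.
have [x [Bx Cx]] := pq _ _ (nbhs_set_val _ _ p B pB) (nbhs_set_val _ _ q C qC).
by exists (set_val x).
Qed.

Lemma dense_closure_set_type (T : topologicalType) (A : set T) :
  dense [set x : closure A | A (set_val x)].
Proof.
move=> W [x Wx] [U oU UE]; have Ux : U (set_val x) by rewrite -UE in Wx.
rewrite -UE.
have [v [Av Uv]] := set_valP x U (open_nbhs_nbhs (conj oU Ux)).
by exists (SigSub (mem_set (subset_closure Av))).
Qed.

(** This lets a fibre over a boundary point be approached from within the domain, where the Riemann
    map is invertible. *)
Lemma fibre_sub_closure (T Y : topologicalType) (f : T -> Y) (S : set T)
    (y : Y) (N : set Y) : continuous f -> dense S -> nbhs y N ->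
  f @^-1` [set y] `<=` closure (S `&` f @^-1` N).
Proof.
move=> cf dS yN x xy B xB.
have xN : nbhs x (f @^-1` N) by apply: cf; rewrite xy.
have : nbhs x ((f @^-1` N) `&` B) by exact: filterI.
rewrite nbhsE => -[W [oW Wx] WNB].
have [v [Wv Sv]] := dS W (ex_intro _ x Wx) oW.
by have [Nv Bv] := WNB v Wv; exists v.
Qed.

(** * Convex sets in the plane *)

Lemma connected_convex_complex (R : realType) (A : set R[i]) :
  (forall x y (t : R), A x -> A y -> 0 <= t <= 1 -> A (x + t%:C * (y - x))) ->
  connected A.
Proof.
move=> cvxA; have [->|/set0P[x Ax]] := eqVneq A set0; first exact: connected0.
(* [A] is a union of segments sharing the endpoint [x]. *)
pose seg y := (fun t : R => x + t%:C * (y - x)) @` `[0, 1].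
have -> : A = \bigcup_(y in A) seg y.
  apply/seteqP; split=> [y Ay|z [y Ay [t t01 <-]]]; last first.
    by apply: cvxA => //; move: t01; rewrite /= in_itv.
  exists y => //; exists 1; first by rewrite /= in_itv /= lexx ler01.
  by rewrite mul1r addrC subrK.
apply: bigcup_connected => [|y Ay].
  exists x => y Ay; exists 0; first by rewrite /= in_itv /= lexx ler01.
  by rewrite mul0r addr0.
apply: connected_continuous_connected; first exact: segment_connected.
apply: continuous_subspaceT => t; apply: cvgD; first exact: cvg_cst.
apply: cvgM; last exact: cvg_cst.
exact: continuous_real_complex.
Qed.

Lemma ball_segment (R : realType) (c x y e : R[i]) (t : R) :
  ball c e x -> ball c e y -> 0 <= t <= 1 -> ball c e (x + t%:C * (y - x)).
Proof.
rewrite -ball_normE /= => cx cy /andP[t0 t1].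
have -> : c - (x + t%:C * (y - x)) = (1 - t%:C) * (c - x) + t%:C * (c - y) by
  ring.
have t0' : 0 <= t%:C by rewrite lecR.
have t1' : 0 <= 1 - t%:C by rewrite subr_ge0 lecR.
rewrite (le_lt_trans (ler_normD _ _))// !normrM (ger0_norm t0') (ger0_norm t1').
(* Norms are real, hence comparable; the convex combination is at most the larger one. *)
have [xy|/ltW yx] := real_leP (normr_real (c - x)) (normr_real (c - y)).
- apply: le_lt_trans cy; rewrite [leRHS](_ :
  _ = (1 - t%:C) * `|c - y| + t%:C * `|c - y|); last by ring.
  by rewrite lerD2r ler_wpM2l.
- apply: le_lt_trans cx; rewrite [leRHS](_ :
  _ = (1 - t%:C) * `|c - x| + t%:C * `|c - x|); last by ring.
  by rewrite lerD2l ler_wpM2l.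
Qed.

Lemma unit_diskE (R : realType) : unit_disk R = ball 0 1.
Proof. by apply/seteqP; split=> z; rewrite -ball_normE /= sub0r normrN. Qed.

(** * The extended Riemann map: surjectivity and connected fibres *)

Section riemann_map.
Context (R : realType) (G : set R[i]) (phi : R[i] -> R[i]).
Context (bG : bounded_set G) (oG : open G) (rphi : riemann_map G phi).
Context (cphi : {within closure G, continuous phi}).

Let phib : closure G -> closure (unit_disk R) := closure_map rphi cphi.

Lemma closure_map_continuous : continuous phib.
Proof. by apply: continuous_comp_initial; exact/subspace_sigL_continuousP. Qed.

Lemma compact_closure_domain : compact (closure G).
Proof.
apply: complex_bounded_closed_compact; last exact: closed_closure.
have [M [Mr GM]] := bG; exists M; split => // N /GM {}GN z Gz.
have : closure G `<=` [set y | `|0 - y| <= N].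
  rewrite [X in _ `<=` X](iffLR (closure_id _) (closed_norm_le _ _ _ _)).
  by apply: closure_subset => y /GN; rewrite /= sub0r normrN.
by move=> /(_ _ Gz) /=; rewrite sub0r normrN.
Qed.

(** The image of the compact closure of [G] is closed and contains the open disk. *)
Lemma closure_map_surjective z : exists w, phib w = z.
Proof.
have [_ _ phiG] := rphi.
have cI : closed (phi @` closure G).
  apply: compact_closed; first exact: norm_hausdorff.
  exact: continuous_compact cphi compact_closure_domain.
have [w Gw wz] : (phi @` closure G) (set_val z).
  have := set_valP z; apply: (subset_trans (closure_subset _) (cI :
    closure _ `<=` _)).
  by rewrite -phiG; apply: image_subset; exact: subset_closure.
by exists (SigSub (mem_set Gw)); apply: val_inj.
Qed.

Lemma closure_map_fibre_connected z : connected (phib @^-1` [set z]).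
Proof.
have [anphi injphi phiG] := rphi.
have hC : hausdorff_space R[i] by exact: norm_hausdorff.
apply: connected_fibre.
- exact: compact_set_type compact_closure_domain.
- exact: hausdorff_set_type.
- exact: hausdorff_set_type.
- exact: closure_map_continuous.
have phiW : {within G, continuous phi}.
  exact: continuous_subspaceW (@subset_closure _ G) cphi.
have D0 : unit_disk R 0 by rewrite /unit_disk /= normr0.
have inv w : unit_disk R w -> exists x :
  closure G, G (set_val x) /\ phi (set_val x) = w.
  rewrite -phiG => -[v Gv vw].
  by exists (SigSub (mem_set (subset_closure Gv))).
(* [psi] inverts [phi] on the open disk; outside it takes arbitrary values, so that it is a total
   function. *)
have /choice[psi psiP] w : exists x : closure G,
    unit_disk R w -> G (set_val x) /\ phi (set_val x) = w.
  have [/inv[x xw]|nD] := pselect (unit_disk R w); first by exists x.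
  by have [x _] := inv _ D0; exists x.
have oD : open (unit_disk R) by rewrite unit_diskE; exact: ball_open.
(* Continuity into the subtype is tested after [set_val], where it is the open mapping property of
   [phi]. *)
have cpsi : {within unit_disk R, continuous psi}.
  apply: (@continuous_comp_initial _ (subspace (unit_disk R))).
  rewrite (continuous_open_subspace _ oD) => w /set_mem Dw V nV.
  have [Gw phiw] := psiP w Dw.
  have := injective_analytic_nbhs R G phi _ V oG anphi injphi phiW Gw nV.
  rewrite phiw; apply: filterS => _ [v [Vv Gv] <-].
  have Dv : unit_disk R (phi v) by rewrite -phiG; exists v.
  have [Gv' /injphi vv] := psiP _ Dv.
  by rewrite /= vv ?inE.
move=> N [_ [] [U oU <-] Uz UN].
have /nbhs_ballP[e /= e0 eU] : nbhs (set_val z) U by exact: open_nbhs_nbhs.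
(* The intersection of two disks is convex, so its image under [psi] is connected. *)
exists (psi @` (unit_disk R `&` ball (set_val z) e)); split.
- apply: connected_continuous_connected.
    apply: connected_convex_complex => x y t [x1 xe] [y1 ye] t01.
    split; last exact: ball_segment.
    by move: x1 y1; rewrite unit_diskE => x1 y1; exact: ball_segment.
  by apply: continuous_subspaceW cpsi.
- move=> _ [w [Dw zw] <-]; apply: UN; apply: eU.
  by have [_] := psiP _ Dw; rewrite closure_mapE => ->.
have nz : nbhs z (set_val @^-1` ball (set_val z) e).
  by apply: nbhs_set_val; exact: nbhsx_ballx.
(* Density of [G] in its closure puts the fibre in the closure of the points of [G] over the ball,
   and each of these is the [psi] of its own image. *)
apply: (subset_trans (fibre_sub_closure _ _ phib _ z _ closure_map_continuous
  (dense_closure_set_type _ G) nz)).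
apply: closure_subset => x [/= Gx zx].
have Dx : unit_disk R (phi (set_val x)) by rewrite -phiG; exists (set_val x).
have [Gx' /injphi xx] := psiP _ Dx.
exists (phi (set_val x)) => //; apply: val_inj.
by rewrite -set_valE xx ?inE.
Qed.

End riemann_map.

(** Since no fibre is empty, the equation for [phihat] determines it at every point of the fibre
    space. *)
Theorem theorem4 (R : realType) (G : set R[i]) (phi : R[i] -> R[i])
    (bG : bounded_set G) (sG : simply_connected_domain G)
    (rphi : riemann_map G phi)
    (cphi : {within closure G, continuous phi}) :
  let phib : closure G -> closure (unit_disk R) := closure_map rphi cphi in
  (forall z : closure (unit_disk R),
     connected (phib @^-1` [set z]) /\ closed (phib @^-1` [set z])) /\
  (forall xb : fibre_space phib, fibre_set xb !=set0) /\
  exists phihat : fibre_space phib -> closure (unit_disk R),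
    (forall (xb : fibre_space phib) (x : closure G),
       fibre_set xb x -> phihat xb = phib x) /\
    homeomorphism phihat.
Proof.
move=> phib; have [oG _ _] := sG.
have hD : hausdorff_space (closure (unit_disk R)).
  by apply: hausdorff_set_type; exact: norm_hausdorff.
have cphib : continuous phib by exact: closure_map_continuous.
have surj z : exists w, phib w = z by exact: closure_map_surjective.
split=> [z|]; last split.
- split; first exact: closure_map_fibre_connected.
  by apply: closed_comp => //; apply: compact_closed => //; exact: compact_set1.
- move=> F; have [z Fz] := fibre_setP _ _ _ F; have [w wz] := surj z.
  by exists w; rewrite Fz.
apply: fibre_space_homeomorphism => //.
exact/compact_set_type/compact_closure_domain.
Qed.
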